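(* Let $q$ be a prime power, $m\ge2$ an integer, and $g(x)=x^m+\sum_{i=2}^{m-1}a_ix^i$ with $a_i\in\mathbb{F}_q$, such that $g(x)+\gamma x$ is a permutation polynomial of $\mathbb{F}_q$ for some $\gamma\in\mathbb{F}_q^*$. Let $\delta_i\in\mathbb{F}_{q^2}$ with $\delta_i^{q+1}=1$, $s(x)=x^q+\delta_ix$, let $\lambda$ be a nonzero element of the image of $s$, and let $L(x)$ be a linearized polynomial over $\mathbb{F}_{q^2}$ of rank $2$ with $L(\ker s)$ not contained in the $\mathbb{F}_q$-span of $\lambda^m$, such that $f(x)=s(x)^m+\sum_{i=2}^{m-1}\lambda^{m-i}a_is(x)^i+L(x)$ is a (normalized) permutation polynomial of $\mathbb{F}_{q^2}$. Then there exist $\delta_j\in\mathbb{F}_{q^2}$ with $\delta_j^{q+1}=1$, a polynomial $g_1\in\mathbb{F}_{q^2}[y]$, and a linearized polynomial $M(x)$ of rank $2$ such that $M(\ker(x^q+\delta_jx))$ is not contained in the $\mathbb{F}_q$-span of the image of $x\mapsto g_1(x^q+\delta_jx)$, and $h(x)=g_1(x^q+\delta_jx)+M(x)$ is the compositional inverse of $f$.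
   Context: A linearized polynomial over $\mathbb{F}_{q^2}$ is $L(x)=\alpha_1x^q+\alpha_0x$ with $\alpha_0,\alpha_1\in\mathbb{F}_{q^2}$; its rank, kernel and image are those of the $\mathbb{F}_q$-linear evaluation map on $\mathbb{F}_{q^2}$. A permutation polynomial of a finite field is one whose evaluation map is a bijection; ''normalized'' means monic and mapping $0$ to $0$. $h$ is the compositional inverse of $f$ if $f(h(x))=h(f(x))=x$ for all $x\in\mathbb{F}_{q^2}$. *)

(* Defs.v *)
From HB Require Import structures.
From mathcomp Require Import all_boot all_order all_algebra all_field.

Set Implicit Arguments.
Unset Strict Implicit.
Unset Printing Implicit Defensive.

Import GRing.Theory.
Local Open Scope ring_scope.

(* The field of q elements is F : finFieldType, so that q is #|F|, and the
   field of q^2 elements is K : fieldExtType F with \dim {:K} = 2; F_q is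
   embedded in K by a |-> a%:A, and F_q-linear maps, subspaces and spans are
   those of K as an F-vector space. *)

Definition permutation_poly (R : nzRingType) (p : {poly R}) : Prop :=
  bijective (fun x : R => p.[x]).

Definition normalized_permutation_poly (R : nzRingType) (p : {poly R}) : Prop :=
  [/\ p \is monic, p.[0] = 0 & permutation_poly p].

Definition compositional_inverse (R : nzRingType) (f h : {poly R}) : Prop :=
  forall x : R, f.[h.[x]] = x /\ h.[f.[x]] = x.

Section Linearized.

Variables (F : finFieldType) (K : fieldExtType F).

(* Coefficients are listed from the top degree down: linpoly 1 delta is
   x^q + delta x. *)
Definition linpoly (alpha1 alpha0 : K) : {poly K} :=
  alpha1 *: 'X^#|F| + alpha0 *: 'X.

(* linfun accepts any function, but returns it as a linear map only when it is
   linear; linmapE below shows that this is the case here. *)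
Definition linmap (alpha1 alpha0 : K) : 'End(K) :=
  linfun (fun x : K => (linpoly alpha1 alpha0).[x]).

Definition linrank (alpha1 alpha0 : K) : nat :=
  \dim (limg (linmap alpha1 alpha0)).

(* finvect_type K is K itself, with its finite type structure. *)
Definition span_image (p : {poly K}) : {vspace K} :=
  <<codom (fun x : finvect_type K => p.[x : K])>>%VS.

Lemma linpoly_linear (alpha1 alpha0 : K) :
  linear (fun x : K => (linpoly alpha1 alpha0).[x]).
Proof.
have exprD (x y : K) : (x + y) ^+ #|F| = x ^+ #|F| + y ^+ #|F|.
  have [p p_pr pcharF] := finPcharP F.
  have pcharK : p \in [pchar K] by rewrite pchar_lalg.
  apply: exprDn_pchar; rewrite (eq_pnat _ (pcharf_eq pcharK)).
  by rewrite (card_pprimeChar pcharF) pnatX pnat_id.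
move=> a x y; rewrite /linpoly !hornerE exprD exprZn expf_card.
by rewrite !mulrDr scalerDr -!scalerAr addrACA [RHS]/= addrA.
Qed.

Lemma linmapE (alpha1 alpha0 x : K) :
  linmap alpha1 alpha0 x = alpha1 * x ^+ #|F| + alpha0 * x.
Proof.
pose f (x : K) := (linpoly alpha1 alpha0).[x].
pose fL := GRing.isLinear.Build F K K *:%R f (@linpoly_linear alpha1 alpha0).
pose ff : {linear K -> K} := HB.pack f fL.
by rewrite /linmap (lfunE ff) /= /f /linpoly !hornerE.
Qed.

End Linearized.

(* Main.v *)
Require Import Defs.
From HB Require Import structures.
From mathcomp Require Import all_boot all_order all_algebra all_field.

Set Implicit Arguments.
Unset Strict Implicit.
Unset Printing Implicit Defensive.

Import GRing.Theory.
Local Open Scope ring_scope.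

(* Since s(x) = t(x) lambda with t(x) in F_q, f(x) = c(x) v + L(x), where
   v = lambda^m and c(x) in F_q depends only on s(x).  Choose k in ker s such
   that w = L(k) is not in <v>, and delta' such that <w> = ker (x^q + delta' x).
   Take M to be the inverse of L.  From y = c(h(y)) v + L(h(y)) we get
   h(y) - M(y) in <M(v)>.  As k in ker s, f(x + bk) = f(x) + bw for b in F_q,
   so h - M is invariant under translation by <w>, i.e. a function of
   y^q + delta' y.  Finally M(w) = k is not in <M(v)> because w is not in <v>. *)

(** Lagrange interpolation: [1 - (x - z) ^+ #|R|.-1] is the indicator of [x = z], as nonzero
    elements have order dividing [#|R|.-1]. *)
Lemma interpolation_finField (R : finFieldType) (phi : R -> R) :
  exists p : {poly R}, forall x, p.[x] = phi x.
Proof.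
have R1_gt0 : (0 < #|R|.-1)%N by rewrite -subn1 subn_gt0 finNzRing_gt1.
exists (\sum_z phi z *: (1 - ('X - z%:P) ^+ #|R|.-1)) => x.
rewrite horner_sum (bigD1 x) //= big1 => [|z neq_zx]; rewrite !hornerE.
  by rewrite subrr expr0n eqn0Ngt R1_gt0 subr0 mulr1.
suff -> : (x - z) ^+ #|R|.-1 = 1 by rewrite subrr mulr0.
apply: (mulfI (_ : x - z != 0)); first by rewrite subr_eq0 eq_sym.
by rewrite -exprS prednK ?expf_card ?mulr1 // ltnW // finNzRing_gt1.
Qed.

Section QuadraticExtension.

Variables (F : finFieldType) (K : fieldExtType F).
Local Notation q := #|F|.

Lemma interpolation_finExt (phi : K -> K) :
  exists p : {poly K}, forall x, p.[x] = phi x.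
Proof. exact: (@interpolation_finField (finvect_type K)). Qed.

Lemma horner_linpoly (alpha1 alpha0 x : K) :
  (linpoly alpha1 alpha0).[x] = linmap alpha1 alpha0 x.
Proof. by rewrite linmapE /linpoly !hornerE. Qed.

Lemma exprqD (x y : K) : (x + y) ^+ q = x ^+ q + y ^+ q.
Proof.
have : linmap 1 0 (x + y) = linmap 1 0 x + linmap 1 0 y by rewrite linearD.
by rewrite !linmapE !mul1r !mul0r !addr0.
Qed.

Lemma exprqN (x : K) : (- x) ^+ q = - x ^+ q.
Proof.
have : linmap 1 0 (- x) = - linmap 1 0 x by rewrite linearN.
by rewrite !linmapE !mul1r !mul0r !addr0.
Qed.

Lemma scalar_exprq (x : K) : x ^+ q = x -> exists c : F, x = c%:A.
Proof.
move=> xq; apply/vlineP.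
by rewrite (Fermat's_little_theorem 1%AS) dimv1 expn1 xq.
Qed.

(** The quotient [x / y] is fixed by the Frobenius map, hence lies in F_q. *)
Lemma proportional_exprq (x y c : K) :
  y != 0 -> x ^+ q = c * x -> y ^+ q = c * y -> exists b : F, x = b *: y.
Proof.
move=> y0 xq yq.
have c0 : c != 0.
  apply: contraNneq y0 => c0; move/eqP: yq.
  by rewrite c0 mul0r expf_eq0 => /andP[].
have [|b xy] := @scalar_exprq (x / y).
  by rewrite expr_div_n xq yq -mulf_div divff ?mul1r.
by exists b; rewrite -[x](divfK y0) xy mulr_algl.
Qed.

(** The value [delta = - w^(q-1)] is forced by [w] being a root. Its norm is 1 since [w^(q^2) = w],
    the two signs cancelling because [(-1)^q = -1] in every characteristic. *)
Lemma lker_line (w : K) : w != 0 -> w ^+ q ^+ q = w ->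
  exists2 delta : K, delta ^+ q.+1 = 1 & lker (linmap 1 delta) = <[w]>%VS.
Proof.
move=> w0 wqq; exists (- (w ^+ q / w)).
  rewrite exprS exprqN mulrNN expr_div_n wqq.
  by rewrite mulrA divfK // divff // expf_neq0.
apply/vspaceP => x; rewrite memv_ker linmapE mul1r mulNr subr_eq0.
apply/eqP/vlineP => [xq | [b ->]].
  by apply: proportional_exprq xq _; rewrite ?divfK.
by rewrite exprZn expf_card -scalerAr divfK.
Qed.

Hypothesis dimK : \dim {:K} = 2%N.

Lemma exprqq (x : K) : x ^+ q ^+ q = x.
Proof.
apply/eqP; rewrite -exprM mulnn -dimK -(Fermat's_little_theorem {:K}%AS).
exact: memvf.
Qed.

(** Raising [u = x^q + delta x] to the power [q] gives [x + delta^q x^q = delta^q u], so all values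
    of the map satisfy one equation [u^q = c u] and are proportional over F_q. *)
Lemma limg_line (delta lambda x : K) : delta ^+ q.+1 = 1 ->
  lambda != 0 -> lambda \in limg (linmap 1 delta) ->
  exists t : F, linmap 1 delta x = t *: lambda.
Proof.
move=> delta1 lambda0 /memv_imgP[z _ def_lambda].
have img_exprq u : linmap 1 delta u ^+ q = delta ^+ q * linmap 1 delta u.
  rewrite linmapE mul1r exprqD exprMn exprqq mulrDr mulrA -exprSr delta1 mul1r.
  exact: addrC.
by apply: (@proportional_exprq _ _ (delta ^+ q)) => //; rewrite def_lambda.
Qed.

(** It suffices to match [phi] on a basis [e, 1]. This is a 2 by 2 linear system with determinant
    [e^q - e], nonzero for [e] outside F_q. *)
Lemma linmap_onto (phi : 'End(K)) : exists mu1 mu0, linmap mu1 mu0 = phi.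
Proof.
have /subvPn[e _ e_notF] : ~~ ({:K} <= 1)%VS.
  by apply/negP => /dimvS; rewrite dimK dimv1.
have span_e : <<[:: e; 1%R]>>%VS = fullv.
  apply: span_basis.
  rewrite basisEfree dimK subvf free_cons span_seq1 e_notF seq1_free.
  by rewrite oner_eq0.
have eq_e : e ^+ q - e != 0.
  rewrite subr_eq0; apply: contraNneq e_notF => /scalar_exprq[c ->].
  exact: memvZ (mem1v _).
(* Solution of [mu1 + mu0 = phi 1] and [mu1 e^q + mu0 e = phi e]. *)
pose mu1 := (phi e - phi 1 * e) / (e ^+ q - e).
exists mu1, (phi 1 - mu1); apply/eqP; rewrite -subr_eq0.
set psi := _ - phi.
have ker_psi : lker psi = fullv.
  apply/eqP; rewrite eqEsubv subvf -span_e.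
  apply/span_subvP => x; rewrite !inE memv_ker !lfun_simp => /pred2P[] ->.
    have -> : linmap mu1 (phi 1 - mu1) e = mu1 * (e ^+ q - e) + phi 1 * e.
      by rewrite linmapE mulrBl mulrBr addrAC addrA.
    by rewrite divfK // subrK subrr.
  by rewrite linmapE expr1n !mulr1 [mu1 + _]addrC subrK subrr.
apply/eqP/lfunP => x; rewrite zero_lfunE; apply/eqP.
by rewrite -memv_ker ker_psi memvf.
Qed.

Lemma linmap_rank2 (mu1 mu0 : K) :
  linrank mu1 mu0 = 2%N <-> lker (linmap mu1 mu0) == 0%VS.
Proof.
rewrite /linrank; split=> [rk | /eqP ker0].
  have := limg_ker_dim (linmap mu1 mu0) fullv.
  by rewrite capfv rk dimK -[RHS]add0n => /addIn/eqP; rewrite dimv_eq0.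
by rewrite limg_dim_eq // ker0 capv0.
Qed.

End QuadraticExtension.

Theorem theorem8 (F : finFieldType) (K : fieldExtType F)
  (dimK : \dim {:K} = 2%N)
  (m : nat) (m_ge2 : (2 <= m)%N) (a : nat -> F)
  (g_perm : exists gamma : F, gamma != 0 /\
     permutation_poly
       ('X^m + \sum_(2 <= i < m) a i *: 'X^i + gamma *: 'X : {poly F}))
  (delta : K) (delta_norm1 : delta ^+ #|F|.+1 = 1)
  (lambda : K) (lambda_neq0 : lambda != 0)
  (lambda_im : lambda \in limg (linmap 1 delta))
  (alpha1 alpha0 : K) (L_rank2 : linrank alpha1 alpha0 = 2%N)
  (L_ker : ~ (linmap alpha1 alpha0 @: lker (linmap 1 delta)
                <= <[lambda ^+ m]>)%VS)
  (f : {poly K})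
  (f_def : f = linpoly 1 delta ^+ m
             + \sum_(2 <= i < m)
                 (lambda ^+ (m - i) * (a i)%:A) *: linpoly 1 delta ^+ i
             + linpoly alpha1 alpha0)
  (f_perm : normalized_permutation_poly f) :
  exists (delta' : K) (g1 : {poly K}) (mu1 mu0 : K),
    [/\ delta' ^+ #|F|.+1 = 1,
        linrank mu1 mu0 = 2%N,
        ~ (linmap mu1 mu0 @: lker (linmap 1 delta')
             <= span_image (g1 \Po linpoly 1 delta'))%VS
      & compositional_inverse f (g1 \Po linpoly 1 delta' + linpoly mu1 mu0)].
Proof.
case: f_perm => _ _ [h fK hK].
set s := linmap 1 delta in L_ker *; set L := linmap alpha1 alpha0 in L_ker *.
set v := lambda ^+ m in L_ker.
have L_inj : lker L == 0%VS by apply/(linmap_rank2 dimK).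
(* The same [c] serves [x] and all its translates by [ker s]. The factors [lambda^(m-i)] make every
   term of the sum an F_q-multiple of [v]. *)
have fE x : exists2 c : F, f.[x] = c *: v + L x
                         & forall z, s z = 0 -> f.[x + z] = c *: v + L (x + z).
  have [t sx] := limg_line dimK x delta_norm1 lambda_neq0 lambda_im.
  have {}fE y : s y = t *: lambda ->
      f.[y] = (t ^+ m + \sum_(2 <= i < m) a i * t ^+ i) *: v + L y.
    move=> sy; have {sy} lin_y : (linpoly 1 delta).[y] = t *: lambda.
      by rewrite horner_linpoly.
    rewrite f_def hornerD [(_ + \sum_(_ <= _ < _) _).[y] ]hornerD horner_exp.
    rewrite lin_y horner_sum horner_linpoly exprZn scalerDl scaler_suml.
    congr (_ + _ + _).
    apply: eq_big_nat => i /andP[_ lt_im].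
    rewrite hornerZ horner_exp lin_y exprZn -scalerAr -mulrA mulr_algl.
    by rewrite -scalerAr -exprD subnK 1?ltnW // scalerA mulrC.
  exists (t ^+ m + \sum_(2 <= i < m) a i * t ^+ i); first exact: fE.
  by move=> z sz; apply: fE; rewrite linearD /= sz addr0.
have /subvPn[w /memv_imgP[k]] := introN idP L_ker.
rewrite memv_ker => /eqP sk -> Lk_v {w}; pose w := L k.
have w0 : w != 0 by apply: contraNneq Lk_v; rewrite -/w => ->; apply: mem0v.
have [delta' delta'1 ker_s'] := lker_line w0 (exprqq dimK w).
set s' := linmap 1 delta' in ker_s'.
have [mu1 [mu0 def_M]] := linmap_onto dimK L^-1%VF.
set M := linmap mu1 mu0 in def_M.
have LK : cancel L M by rewrite def_M; apply: lker0_lfunK.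
have MK : cancel M L by rewrite def_M; apply: lker0_lfunVK.
have h_sub_M y : h y - M y \in <[M v]>%VS.
  have [c def_y _] := fE (h y); rewrite hK in def_y.
  have -> : M y = c *: M v + h y by rewrite {1}def_y linearD linearZ /= LK.
  by apply/vlineP; exists (- c); rewrite opprD addrCA subrr addr0 scaleNr.
have h_sub_M_ker y y' : s' y = s' y' -> h y - M y = h y' - M y'.
  move=> eq_s'; have : y' - y \in lker s'.
    by rewrite memv_ker linearB /= eq_s' subrr.
  rewrite ker_s' => /vlineP[b /(canRL (subrK _)) ->].
  have [c fhy fhy_ker] := fE (h y).
  (* Both sides have the same image under the injective [f], because [b *: k] is in [ker s]. *)
  have -> : h (b *: w + y) = h y + b *: k.
    apply: (can_inj fK); rewrite hK fhy_ker ?linearZ /= ?sk ?scaler0 //.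
    by rewrite linearD linearZ /= addrA -fhy hK addrC.
  by rewrite linearD linearZ /= LK addrKA.
(* By the invariance just shown, the choice of preimage under [s'] is immaterial. The default 0 is
   taken only outside the image of [s'], where [phi] is never evaluated below. *)
pose phi z := if [pick y : finvect_type K | s' y == z] is Some y
              then h y - M y else 0.
have [g1 g1E] := interpolation_finExt phi.
have g1s' y : (g1 \Po linpoly 1 delta').[y] = h y - M y.
  rewrite horner_comp g1E horner_linpoly -/s' /phi.
  by case: pickP => [y' /eqP/h_sub_M_ker // | /(_ y)]; rewrite eqxx.
exists delta', g1, mu1, mu0; split=> //.
- by apply/(linmap_rank2 dimK)/lker0P; apply: can_inj MK.
(* All values of [g1] on the image of [s'] lie in [<[M v]>]. The inclusion would put [M w] there,
   and applying [L] would put [w] in [<[v]>]. *)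
- rewrite -/s' -/M ker_s' => sub_span; case/negP: Lk_v.
  have : M w \in <[M v]>%VS.
    suff /subvP : (span_image (g1 \Po linpoly 1 delta') <= <[M v]>)%VS.
      by apply; apply: (subvP sub_span); apply: memv_img (memv_line w).
    by apply/span_subvP => _ /codomP[y ->]; rewrite g1s'.
  case/vlineP => b /(congr1 L); rewrite linearZ /= !MK => Lk.
  by apply/vlineP; exists b.
move=> x; rewrite !(hornerD (g1 \Po _)) !g1s' !horner_linpoly -/M.
by rewrite !subrK fK hK.
Qed.
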